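(* For $i\in\{1,2\}$ let $P_i=\{(x,z)\in\mathbb R^{n_i}\times\mathbb R^{p_i}\mid A_C^ix+A_I^iz\le b^i\}$ be a polyhedron with rational data, with $z$ the integer variables. Let $\varphi:\mathbb R^{n_1}\times\mathbb R^{p_1}\to\mathbb R^{n_2}\times\mathbb R^{p_2}$ be a mixed-integer-compatible map with $\varphi(P_1)\subseteq P_2$. Then $\varphi((P_1)_{\mathrm{split}})\subseteq(P_2)_{\mathrm{split}}$.
   Context: A map $\varphi:\mathbb R^{n_1}\times\mathbb R^{p_1}\to\mathbb R^{n_2}\times\mathbb R^{p_2}$ is mixed-integer-compatible if it is affine and $\varphi(\mathbb R^{n_1}\times\mathbb Z^{p_1})\subseteq\mathbb R^{n_2}\times\mathbb Z^{p_2}$. For a polyhedron $P\subseteq\mathbb R^n\times\mathbb R^p$ with variables $(x,z)$, $z$ being the integer variables, the split closure is $$P_{\mathrm{split}}=\bigcap_{(\beta,\beta_0)\in\mathbb Z^p\times\mathbb Z}\operatorname{conv}(\{(x,z)\in P\mid\beta^\top z\le\beta_0\}\cup\{(x,z)\in P\mid\beta^\top z\ge\beta_0+1\})=\bigcap_{\beta\in\mathbb Z^p}\operatorname{conv}\{(x,z)\in P\mid\beta^\top z\in\mathbb Z\}.$$ *)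

(* Defs.v *)
From mathcomp Require Import all_boot all_order all_algebra.
From mathcomp Require Import boolp classical_sets reals convex.

Set Implicit Arguments.
Unset Strict Implicit.
Unset Printing Implicit Defensive.
Import Order.TTheory GRing.Theory Num.Theory.
Local Open Scope classical_set_scope.
Local Open Scope ring_scope.

(* A point of R^n x R^p is a pair (x, z) of column vectors; the integer
   variables are those of the second component. *)
Notation mixed_space R n p := ('cV[R]_n * 'cV[R]_p)%type.

Definition mixed_lattice (R : realType) (n p : nat) : set (mixed_space R n p) :=
  [set u : mixed_space R n p | forall i, u.2 i 0 \is a Num.int].
Arguments mixed_lattice : clear implicits.

Definition rat_polyhedron (R : realType) (m n p : nat)
    (AC : 'M[rat]_(m, n)) (AI : 'M[rat]_(m, p)) (b : 'cV[rat]_m) :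
    set (mixed_space R n p) :=
  [set u : mixed_space R n p | forall i, (map_mx ratr AC *m u.1 + map_mx ratr AI *m u.2) i 0
                     <= ratr (b i 0)].
Arguments rat_polyhedron R {m n p} AC AI b.

Definition is_affine (R : realType) (E F : lmodType R) (f : E -> F) : Prop :=
  exists (l : {linear E -> F}) (c : F), forall u, f u = l u + c.

Definition mixed_integer_compatible (R : realType) (n1 p1 n2 p2 : nat)
    (phi : mixed_space R n1 p1 -> mixed_space R n2 p2) : Prop :=
  is_affine phi /\
  phi @` mixed_lattice R n1 p1 `<=` mixed_lattice R n2 p2.

Definition conv_hull (R : realType) (E : lmodType R) (A : set E) : set E :=
  smallest (@convex_set R E) A.

Definition int_dot (R : realType) (p : nat) (beta : 'cV[int]_p) (z : 'cV[R]_p) :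
    R :=
  ((map_mx intr beta)^T *m z) 0 0.

Definition split_closure (R : realType) (n p : nat)
    (P : set (mixed_space R n p)) : set (mixed_space R n p) :=
  \bigcap_(bb in [set: 'cV[int]_p * int])
    conv_hull ([set u : mixed_space R n p | P u /\ int_dot bb.1 u.2 <= bb.2%:~R]
           `|` [set u : mixed_space R n p | P u /\ bb.2%:~R + 1 <= int_dot bb.1 u.2]).

(* Main.v *)
(** For an integral covector beta, the functional beta^T (phi(x, z))_2 is an
    affine function taking integer values on R^n1 x Z^p1.  It therefore ignores
    x (a nonzero linear functional on a real space is onto R), and equals
    gamma^T z + k with gamma and k integral.  So phi maps the split disjunction
    (gamma, beta_0 - k) of P1 into the disjunction (beta, beta_0) of P2, and
    affine maps commute with convex hulls. *)

Require Import Defs.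
From HB Require Import structures.
From mathcomp Require Import all_boot all_order all_algebra.
From mathcomp Require Import boolp classical_sets reals convex.

Import Order.TTheory GRing.Theory Num.Theory.

Local Open Scope classical_set_scope.
Local Open Scope ring_scope.

(** If [f u] were nonzero, rescaling [u] by [(f u)^-1 / 2] would produce the value 1/2, which is not
    an integer. *)
Lemma scalar_int_eq0 (R : realType) (E : lmodType R) (f : {scalar E}) :
  (forall u, f u \is a Num.int) -> forall u, f u = 0.
Proof.
move=> f_int u; apply/eqP/negPn/negP => fu0.
have /norm_intr_ge1 := f_int (((f u)^-1 / 2) *: u).
rewrite linearZ /= mulrAC mulVf // mul1r => /(_ _).
rewrite invr_eq0 pnatr_eq0 => /(_ isT).
by rewrite ger0_norm ?invr_ge0 // invf_ge1 // lern1.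
Qed.

Lemma int_dotE (R : realType) (p : nat) (beta : 'cV[int]_p) (z : 'cV[R]_p) :
  int_dot beta z = \sum_i (beta i 0)%:~R * z i 0.
Proof. by rewrite /int_dot mxE; apply: eq_bigr => i _; rewrite !mxE. Qed.

Lemma int_dot_is_scalar (R : realType) (p : nat) (beta : 'cV[int]_p) :
  scalar (int_dot beta : 'cV[R]_p -> R).
Proof. by move=> a u v; rewrite /int_dot mulmxDr -scalemxAr !mxE. Qed.

(** Makes composites such as [int_dot beta \o snd \o l] recognizable as linear forms. *)
HB.instance Definition _ (R : realType) (p : nat) (beta : 'cV[int]_p) :=
  GRing.isLinear.Build R 'cV[R]_p R *%R (int_dot beta)
    (@int_dot_is_scalar R p beta).

Lemma int_dot_int (R : realType) (p : nat) (beta : 'cV[int]_p) (z : 'cV[R]_p) :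
  (forall i, z i 0 \is a Num.int) -> int_dot beta z \is a Num.int.
Proof.
by move=> z_int; rewrite int_dotE rpred_sum // => i _; rewrite rpredM ?intr_int.
Qed.

(** Every [(x, 0)] is a lattice point, so [f] is integral, hence zero, on the continuous part; the
    unit vectors of the integer part are lattice points too, so the remaining coefficients are
    integers. *)
Lemma scalar_mixed_lattice_int (R : realType) (n p : nat)
    (f : {scalar mixed_space R n p}) :
  (forall u, mixed_lattice R n p u -> f u \is a Num.int) ->
  exists gamma : 'cV[int]_p, forall u, f u = int_dot gamma u.2.
Proof.
move=> f_int.
have fx0 (x : 'cV[R]_n) : f (x, 0) = 0.
  have lin : scalar (fun x : 'cV[R]_n => f (x, 0)).
    move=> a x1 x2; rewrite -linearP; congr (f _).
    by congr pair; rewrite /= scaler0 addr0.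
  pose lM := GRing.isLinear.Build R 'cV[R]_n R *%R _ lin.
  pose g : {scalar 'cV[R]_n} := HB.pack (fun x : 'cV[R]_n => f (x, 0)) lM.
  apply: (@scalar_int_eq0 _ _ g) => y; apply: f_int => i /=.
  by rewrite mxE int_num0.
have fe_int i : f (0, delta_mx i 0) \is a Num.int.
  by apply: f_int => j /=; rewrite mxE natr_int.
(* The floor rounds nothing here: by [fe_int] it only turns an integral real into an [int]. *)
exists (\col_i Num.floor (f (0, delta_mx i 0))) => -[x z] /=.
have -> : (x, z) = (x, 0) + \sum_i z i 0 *: (0, delta_mx i 0)
    :> mixed_space R n p.
  congr pair => /=.
  - by rewrite raddf_sum /= big1 ?addr0 // => i _; rewrite scaler0.
  - rewrite raddf_sum /= add0r {1}[z]matrix_sum_delta; apply: eq_bigr => i _.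
    by rewrite big_ord1.
rewrite linearD fx0 add0r linear_sum int_dotE; apply: eq_bigr => i _.
by rewrite linearZ /= mxE floorK // mulrC.
Qed.

Lemma convex_set_preimage_affine (R : realType) (E F : lmodType R)
    (f : E -> F) (A : set F) :
  is_affine f -> @convex_set R F A -> @convex_set R E (f @^-1` A).
Proof.
move=> [l [c fE]] cA x y t /set_mem xA /set_mem yA; apply/mem_set.
(* The weights sum to 1, so the constant [c] is reproduced exactly once. *)
have f_conv (s : R) (a b : E) :
    s *: f a + (1 - s) *: f b = f (s *: a + (1 - s) *: b).
  rewrite !fE [l (_ + _)]linearD !linearZ !scalerDr addrACA -scalerDl.
  by rewrite [s + _]addrC subrK scale1r.
have /set_mem := cA _ _ t (mem_set xA) (mem_set yA).
by congr A; exact: f_conv.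
Qed.

(** The hull is the smallest convex superset, so no explicit combinations are needed: the preimage
    of a convex [C] containing [B] is convex and contains [A], hence contains the hull of [A]. *)
Lemma conv_hull_image_affine (R : realType) (E F : lmodType R)
    (f : E -> F) (A : set E) (B : set F) :
  is_affine f -> f @` A `<=` B -> f @` conv_hull A `<=` conv_hull B.
Proof.
move=> f_aff fAB _ [u hu <-] C [cC BC].
apply: (hu (f @^-1` C)); split; first exact: convex_set_preimage_affine.
by move=> a Aa; apply/BC/fAB; exists a.
Qed.

Lemma mixed_integer_compatible_int_dot (R : realType) (n1 p1 n2 p2 : nat)
    (phi : mixed_space R n1 p1 -> mixed_space R n2 p2) (beta : 'cV[int]_p2) :
  mixed_integer_compatible phi ->
  exists (gamma : 'cV[int]_p1) (k : int),
    forall u, int_dot beta (phi u).2 = int_dot gamma u.2 + k%:~R.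
Proof.
move=> [[l [c phiE]] phi_int].
have phi_dot_int u : mixed_lattice R n1 p1 u ->
    int_dot beta (phi u).2 \is a Num.int.
  by move=> u_int; apply: int_dot_int; apply: phi_int; exists u.
have phi_dotE u :
    int_dot beta (phi u).2 = int_dot beta (l u).2 + int_dot beta c.2.
  by rewrite phiE linearD.
have c_int : int_dot beta c.2 \is a Num.int.
  (* [c] is the image under [phi] of the origin, a lattice point. *)
  rewrite -[c]add0r -(linear0 l) -phiE; apply: phi_dot_int => i.
  by rewrite mxE int_num0.
(* On the lattice, the linear part differs from an integer value by the integer [int_dot beta c.2],
   so it is integral as well. *)
have [|gamma gammaE] :=
    @scalar_mixed_lattice_int R n1 p1 (int_dot beta \o snd \o l).
  by move=> u u_int; rewrite -(rpredDr _ c_int) -phi_dotE phi_dot_int.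
exists gamma, (Num.floor (int_dot beta c.2)) => u.
by rewrite phi_dotE floorK // -gammaE.
Qed.

Theorem theorem5p3 (R : realType) (m1 n1 p1 m2 n2 p2 : nat)
    (AC1 : 'M[rat]_(m1, n1)) (AI1 : 'M[rat]_(m1, p1)) (b1 : 'cV[rat]_m1)
    (AC2 : 'M[rat]_(m2, n2)) (AI2 : 'M[rat]_(m2, p2)) (b2 : 'cV[rat]_m2)
    (phi : mixed_space R n1 p1 -> mixed_space R n2 p2) :
  mixed_integer_compatible phi ->
  phi @` rat_polyhedron R AC1 AI1 b1 `<=` rat_polyhedron R AC2 AI2 b2 ->
  phi @` split_closure (rat_polyhedron R AC1 AI1 b1) `<=`
    split_closure (rat_polyhedron R AC2 AI2 b2).
Proof.
move=> phi_mic phiP _ [u u_split <-] [beta beta0] _ /=.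
have [gamma [k gammaE]] := mixed_integer_compatible_int_dot _ _ _ _ _ _ beta phi_mic.
have phi_aff := phi_mic.1.
apply: (conv_hull_image_affine _ _ _ _ _ _ phi_aff); last first.
  by exists u; first exact: (u_split (gamma, beta0 - k)).
(* Each side of the disjunction goes to the same side: adding [k] turns the bounds [beta0 - k] and
   [beta0 - k + 1] into [beta0] and [beta0 + 1]. *)
move=> _ [v + <-] /= => -[[Pv hv]|[Pv hv]]; [left | right]; split;
  rewrite ?gammaE; try by apply: phiP; exists v.
- by rewrite -lerBrDr -intrB.
- by rewrite -lerBlDr addrAC -intrB.
Qed.
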